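(* Let $\mathcal{H} = (Q, I, O, q_0, \delta, \lambda)$ be a Mealy machine, let $k \in \mathbb{N}$, let $P \subseteq I^*$ be a minimal state cover for $\mathcal{H}$ and let $W \subseteq I^*$ be a characterization set for $\mathcal{H}$. Let $I' = I^{\mathsf{active}(\mathcal{H})}$ be the set of inputs that are active in at least one state of $\mathcal{H}$, and consider the test suite \[ T = \mathsf{ETS}_{E_{\mathsf{AI}},k}(\mathcal{H}) = \bigcup_{v \in P} \big( v \cdot (I')^{\leq k-1} \cdot I^{\leq 2} \cdot W \big) = P \cdot (I')^{\leq k-1} \cdot I^{\leq 2} \cdot W. \] Let $\mathcal{C}$ be the set of all Mealy machines $\mathcal{S}$ with input set $I$ such that $|\mathcal{S}| - |\mathcal{H}| \leq k$ and \[ Q^{\mathcal{S}} \setminus Q^{\mathcal{S}}_{sink} \subseteq \Delta^{\mathcal{S}}\big(P \cdot (I')^{\leq k}\big). \] Then $T$ is complete for $\mathcal{H}$ with respect to $\mathcal{C}$: for every $\mathcal{S} \in \mathcal{C}$, if $\mathcal{H} \sim_T \mathcal{S}$ then $\mathcal{H} \sim \mathcal{S}$.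
   Context: A Mealy machine is a tuple $\mathcal{M} = (Q, I, O, q_0, \delta, \lambda)$ with finite sets $Q, I, O$ of states, inputs and outputs, initial state $q_0 \in Q$, transition function $\delta: Q \times I \to Q$ and output function $\lambda: Q \times I \to O$. A partial Mealy machine is the same but with $\delta,\lambda$ partial functions with the same domain. $\delta$ and $\lambda$ are extended to words in the standard way ($\delta(q,\varepsilon)=q$, $\delta(q,wi)=\delta(\delta(q,w),i)$, and $\lambda(q,w)$ is the sequence of outputs produced along $w$); $\delta(w)$ abbreviates $\delta(q_0,w)$. Superscripts (e.g. $Q^{\mathcal{M}}, \delta^{\mathcal{M}}$) indicate the machine. $|\mathcal{M}|$ is the number of states. For $Q' \subseteq Q$ and $L \subseteq I^*$, $\Delta^{\mathcal{M}}(Q', L) = \{\delta(q,w) \mid q \in Q', w \in L\}$ (only defined values) and $\Delta^{\mathcal{M}}(L) = \Delta^{\mathcal{M}}(\{q_0\}, L)$. A state $q$ is a sink if $\delta(q,i)=q$ for all $i \in I$; $Q_{sink}$ denotes the set of sinks. For sets of words, $\cdot$ is concatenation, and $J^{\leq n}$ is the set of words over $J$ of length at most $n$. For $L \subseteq I^*$ and machines $\mathcal{H},\mathcal{S}$ with input set $I$, states $p \in Q^{\mathcal{H}}$, $q \in Q^{\mathcal{S}}$ are $L$-equivalent ($p \sim_L q$) if $\lambda^{\mathcal{H}}(p,w) = \lambda^{\mathcal{S}}(q,w)$ for all $w \in L$; they are equivalent ($p \sim q$) if $I^*$-equivalent; $\mathcal{H} \sim_L \mathcal{S}$ (resp. $\mathcal{H}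 \sim \mathcal{S}$) means $q_0^{\mathcal{H}} \sim_L q_0^{\mathcal{S}}$ (resp. $\sim$). A test suite $T \subseteq I^*$ is complete for $\mathcal{H}$ w.r.t. a set $\mathcal{C}$ of Mealy machines if for all $\mathcal{S} \in \mathcal{C}$, $\mathcal{H} \sim_T \mathcal{S}$ implies $\mathcal{H} \sim \mathcal{S}$. A state cover for $\mathcal{H}$ is $P \subseteq I^*$ with $\varepsilon \in P$ and $\Delta^{\mathcal{H}}(P) = \Delta^{\mathcal{H}}(I^* )$; minimal means of minimal size. A characterization set for $\mathcal{H}$ is a non-empty $W \subseteq I^*$ such that for all $p,q \in Q^{\mathcal{H}}$, $p \sim_W q$ implies $p \sim q$. An input $i$ is active in state $q$ if $\delta(q,i) \notin Q_{sink}$ and $\delta(q,i) \neq q$. The active Mealy machine $\mathsf{active}(\mathcal{H})$ is the partial Mealy machine with states $Q \setminus Q_{sink}$, input set $I^{\mathsf{active}(\mathcal{H})} = \{ i \in I \mid \exists q \in Q.\ i \text{ active in } q\}$, outputs $O$, initial state $q_0$, and $\delta'(q,i) = \delta(q,i)$, $\lambda'(q,i)=\lambda(q,i)$ if $i$ is active in $q$, undefined otherwise.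
   Formalization: The machine H is assumed minimal (all states reachable, equivalent states equal), since the claim fails without it; and for k = 0 the exponent k−1 is read as 0, since otherwise T would be empty and the claim false. *)

(* Defs.v *)
From HB Require Import structures.
From mathcomp Require Import all_boot finmap.
From mathcomp Require Import boolp classical_sets functions cardinality.

Set Implicit Arguments.
Unset Strict Implicit.
Unset Printing Implicit Defensive.

Local Open Scope classical_set_scope.
Local Open Scope card_scope.

(* The finite output set is part of the machine; all output sets live in a
   common, possibly infinite universe [U], so that machines with different
   output sets can be compared. *)
Record mealy (I : finType) (U : choiceType) := Mealy {
  state : finType;
  outputs : {fset U};
  init : state;
  delta : state -> I -> state;
  lambda : state -> I -> outputs
}.

Section Words.
Context {I : finType}.

Definition lang_cat (A B : set (seq I)) : set (seq I) :=
  [set u ++ v | u in A & v in B].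

Definition words_le (J : set I) (n : nat) : set (seq I) :=
  [set w | (size w <= n)%N /\ (forall i, i \in w -> J i)].

End Words.

Section Machines.
Context {I : finType} {U : choiceType}.
Implicit Types (M H S : mealy I U) (L P W T : set (seq I)).

Definition delta_word M (q : state M) (w : seq I) : state M :=
  foldl (@delta _ _ M) q w.

Fixpoint lambda_word M (q : state M) (w : seq I) : seq U :=
  if w is i :: w' then
    fsval (lambda q i) :: lambda_word (delta q i) w'
  else [::].

Definition Delta_from M (Q : set (state M)) L : set (state M) :=
  [set delta_word q w | q in Q & w in L].

Definition Delta M L : set (state M) := Delta_from [set init M] L.
Arguments Delta : clear implicits.

Definition sinks M : set (state M) := [set q | forall i, delta q i = q].
Arguments sinks : clear implicits.

Definition state_equiv_on L H S (p : state H) (q : state S) : Prop :=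
  forall w, L w -> lambda_word p w = lambda_word q w.

Definition state_equiv H S (p : state H) (q : state S) : Prop :=
  state_equiv_on setT p q.

Definition mealy_equiv_on L H S : Prop := state_equiv_on L (init H) (init S).

Definition mealy_equiv H S : Prop := state_equiv (init H) (init S).

Definition minimal_mealy M : Prop :=
  Delta M setT = setT /\ forall p q : state M, state_equiv p q -> p = q.

Definition complete H (C : mealy I U -> Prop) T : Prop :=
  forall S, C S -> mealy_equiv_on T H S -> mealy_equiv H S.

Definition state_cover H P : Prop := P [::] /\ Delta H P = Delta H setT.

Definition minimal_state_cover H P : Prop :=
  state_cover H P /\ forall P', state_cover H P' -> P #<= P'.

Definition characterization_set H W : Prop :=
  W !=set0 /\
  forall p q : state H, state_equiv_on W p q -> state_equiv p q.

Definition active H (q : state H) (i : I) : Prop :=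
  ~ sinks H (delta q i) /\ delta q i <> q.

Definition active_inputs H : set I := [set i | exists q : state H, active q i].
Arguments active_inputs : clear implicits.

(* For k = 0 the exponent k.-1 is 0: a negative length bound is read as 0. *)
Definition ETS_AI H (k : nat) P W : set (seq I) :=
  lang_cat P
    (lang_cat (words_le (active_inputs H) k.-1)
       (lang_cat (words_le setT 2) W)).

Definition fault_domain H (k : nat) P : mealy I U -> Prop := fun S =>
  (#|state S| <= #|state H| + k)%N /\
  ~` sinks S `<=` Delta S (lang_cat P (words_le (active_inputs H) k)).

End Machines.

Arguments Delta {I U} M L.
Arguments sinks {I U} M.
Arguments active_inputs {I U} H.

(* Main.v *)
Require Import Defs.
From mathcomp Require Import all_boot finmap.
From mathcomp Require Import boolp classical_sets functions cardinality.

(** Put [D_j = Delta S (P . I'^{<= j})]. Words of the state cover lead to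
    [W]-inequivalent states of [H], hence [D_0] has at least [|H|] elements;
    as the chain [D_j] stays constant once two consecutive terms agree, either
    [D_k] is the whole of [S] or [D_k = D_(k-1)]. Take
    [V = P . I'^{<= k}] in the first case and [V = P . I'^{<= k-1} . I^{<= 1}]
    in the second. In both cases [Delta S V] is closed under transitions: in
    the second one a non-sink successor lies in [D_(k-1)], a sink reached from
    a non-sink is one step away from [D_(k-1)], and a sink is its own
    successor. Since the suite contains [V . I^{<= 1} . W], the pairs of states
    of [H] and [S] reached by a common word of [V] form a bisimulation. *)

Set Implicit Arguments.
Unset Strict Implicit.
Unset Printing Implicit Defensive.

(** Each strict inclusion adds at least one element, and by the second hypothesis a first equality
    propagates to all later steps. The form [k.-1.+1] keeps the index meaningful at [k = 0]. *)
Lemma card_chain_or_stationary (T : finType) (D : nat -> {set T}) :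
  (forall j, D j \subset D j.+1) ->
  (forall j, D j.+1 = D j -> D j.+2 = D j.+1) ->
  forall k, #|D 0| + k <= #|D k| \/ D k.-1.+1 = D k.-1.
Proof.
move=> mono stat; elim=> [|k [le_k|stat_k]]; first by left; rewrite addn0.
- have [eqD|neqD] := eqVneq (D k.+1) (D k); first by right.
  left; rewrite addnS; apply: leq_ltn_trans le_k _.
  by apply: proper_card; rewrite finset.properEneq eq_sym neqD mono.
- by right; case: k stat_k => [|k] //= /stat.
Qed.

Section Words.
Context {I : finType}.
Implicit Types (A B C : set (seq I)) (J : set I).

Lemma lang_catP A B u v : A u -> B v -> lang_cat A B (u ++ v).
Proof. by move=> Au Bv; exists u => //; exists v. Qed.

Lemma lang_catA A B C : lang_cat A (lang_cat B C) = lang_cat (lang_cat A B) C.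
Proof.
apply/seteqP; split=> [_ [u Au [_ [v Bv [w Cw <-]] <-]]|].
  by rewrite catA; do 2?apply: lang_catP.
move=> _ [_ [u Au [v Bv <-]] [w Cw <-]].
by rewrite -catA; do 2?apply: lang_catP.
Qed.

Lemma lang_cat_nil A B u : A u -> B [::] -> lang_cat A B u.
Proof. by move=> Au B0; rewrite -[u]cats0; apply: lang_catP. Qed.

Lemma words_le_nil J n : words_le J n [::].
Proof. by split. Qed.

Lemma words_leW J m n w : (m <= n)%N -> words_le J m w -> words_le J n w.
Proof. by move=> le_mn [sz_w Jw]; split=> //; apply: leq_trans le_mn. Qed.

Lemma words_le_rcons J n w i :
  words_le J n.+1 (rcons w i) <-> words_le J n w /\ J i.
Proof.
rewrite /words_le /= size_rcons ltnS.
split=> [[sz_w Jw]|[[sz_w Jw] Ji]]; split=> //.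
- by split=> // j jw; apply: Jw; rewrite mem_rcons in_cons jw orbT.
- by apply: Jw; rewrite mem_rcons mem_head.
- by move=> j; rewrite mem_rcons in_cons => /orP[/eqP->|/Jw].
Qed.

Lemma words_leT_rcons n (w : seq I) i :
  words_le setT n w -> words_le setT n.+1 (rcons w i).
Proof. by move=> w_n; apply/words_le_rcons. Qed.

End Words.

Section Machines.
Context {I : finType} {U : choiceType}.
Implicit Types (M H S : mealy I U) (A L P V W X : set (seq I)) (J : set I).

Lemma delta_word_cat M (q : state M) u v :
  delta_word q (u ++ v) = delta_word (delta_word q u) v.
Proof. exact: foldl_cat. Qed.

Lemma delta_word_rcons M (q : state M) u i :
  delta_word q (rcons u i) = delta (delta_word q u) i.
Proof. exact: foldl_rcons. Qed.

Lemma lambda_word_cat M (q : state M) u v :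
  lambda_word q (u ++ v) = lambda_word q u ++ lambda_word (delta_word q u) v.
Proof. by elim: u q => //= i u IHu q; rewrite IHu. Qed.

Lemma size_lambda_word M (q : state M) u : size (lambda_word q u) = size u.
Proof. by elim: u q => //= i u IHu q; rewrite IHu. Qed.

Lemma lambda_word_cat_inj M N (p : state M) (q : state N) u v :
  lambda_word p (u ++ v) = lambda_word q (u ++ v) ->
  lambda_word p u = lambda_word q u /\
  lambda_word (delta_word p u) v = lambda_word (delta_word q u) v.
Proof.
by rewrite !lambda_word_cat => /eqP; rewrite eqseq_cat ?size_lambda_word //
  => /andP[/eqP-> /eqP->].
Qed.

Lemma DeltaP M L s : Delta M L s <-> exists2 w, L w & delta_word (init M) w = s.
Proof. by split=> [[_ -> ]|Ls] //; exists (init M). Qed.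

Lemma Delta_intro M L w : L w -> Delta M L (delta_word (init M) w).
Proof. by move=> Lw; apply/DeltaP; exists w. Qed.

(** Splitting off the last letter shows that each level depends on the previous one only as a set of
    states; this is why equality of two levels propagates. *)
Lemma Delta_words_leS M A J n s :
  Delta M (lang_cat A (words_le J n.+1)) s <->
  Delta M (lang_cat A (words_le J n)) s \/
  exists q i, [/\ Delta M (lang_cat A (words_le J n)) q, J i & s = delta q i].
Proof.
split=> [/DeltaP[_ [u Au [v Jv <-]] <-]|[]].
- case/lastP: v Jv => [|v i] Jv.
    by left; apply/Delta_intro/lang_catP => //; apply: words_le_nil.
  have [Jv' Ji] := (words_le_rcons _ _ _ _).1 Jv.
  right; exists (delta_word (init M) (u ++ v)), i; split=> //.
    exact/Delta_intro/lang_catP.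
  by rewrite -rcons_cat delta_word_rcons.
- case/DeltaP=> _ [u Au [v Jv <-]] <-; apply/Delta_intro/lang_catP => //.
  exact: words_leW Jv.
- case=> _ [i [/DeltaP[_ [u Au [v Jv <-]] <-] Ji ->]].
  rewrite -delta_word_rcons rcons_cat; apply/Delta_intro/lang_catP => //.
  exact/words_le_rcons.
Qed.

Lemma Delta_card_or_stationary M A J k :
  #|[pred s | `[< Delta M A s >]]| + k
    <= #|[pred s | `[< Delta M (lang_cat A (words_le J k)) s >]]| \/
  (forall s, Delta M (lang_cat A (words_le J k)) s ->
             Delta M (lang_cat A (words_le J k.-1)) s).
Proof.
pose D j := finset (fun s => `[< Delta M (lang_cat A (words_le J j)) s >]).
have memD j s : s \in D j <-> Delta M (lang_cat A (words_le J j)) s.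
  by rewrite inE; split=> /asboolP.
have subD j : D j.+1 = D j -> forall s,
    Delta M (lang_cat A (words_le J j.+1)) s ->
    Delta M (lang_cat A (words_le J j)) s.
  by move=> eqD s /memD; rewrite eqD => /memD.
have mono j : D j \subset D j.+1.
  by apply/fintype.subsetP=> s /memD Ds; apply/memD/Delta_words_leS; left.
have stat j : D j.+1 = D j -> D j.+2 = D j.+1.
  move=> eqD; apply/eqP; rewrite finset.eqEsubset mono andbT.
  apply/fintype.subsetP=> s /memD/Delta_words_leS[/memD //|[q [i [Dq Ji ->]]]].
  apply/memD/Delta_words_leS; right; exists q, i; split=> //.
  exact: subD Dq.
case: (card_chain_or_stationary mono stat k) => [le_k|stat_k]; last first.
  (* For [k = 0] both length bounds are 0 and the inclusion is trivial. *)
  by right; case: k stat_k => //= k; apply: subD.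
left; move: le_k; rewrite [#|D k|]cardsE; apply: leq_trans.
rewrite leq_add2r; apply/subset_leq_card/fintype.subsetP => s.
rewrite inE => /DeltaP[u Au <-]; apply/memD/Delta_intro.
exact/lang_cat_nil/words_le_nil.
Qed.

Lemma state_equiv_on_delta_word H S X W :
  mealy_equiv_on (lang_cat X W) H S -> forall u, X u ->
  state_equiv_on W (delta_word (init H) u) (delta_word (init S) u).
Proof.
by move=> eqT u Xu w Ww; have [] := lambda_word_cat_inj (eqT _ (lang_catP Xu Ww)).
Qed.

(** [W]-equivalence can be composed through [s], so a state of [S] determines its partner in [H]. *)
Lemma characterization_set_inj H S W (p q : state H) (s : state S) :
  minimal_mealy H -> characterization_set H W ->
  state_equiv_on W p s -> state_equiv_on W q s -> p = q.
Proof.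
move=> [_ minH] [_ charW] ps qs; apply/minH/charW => w Ww.
by rewrite ps // qs.
Qed.

(** Choose an access word in [P] for every state of [H]: if two of these words met in [S], their
    states in [H] would share a partner and so coincide. *)
Lemma card_Delta_state_cover H S P W :
  minimal_mealy H -> characterization_set H W -> state_cover H P ->
  mealy_equiv_on (lang_cat P W) H S ->
  #|state H| <= #|[pred s | `[< Delta S P s >]]|.
Proof.
move=> minH charW [_ coverP] eqT.
have /choice[a aP] (p : state H) : exists u, P u /\ delta_word (init H) u = p.
  have /DeltaP[u Pu <-] : Delta H P p by rewrite coverP minH.1.
  by exists u.
have inj_f : injective (fun p => delta_word (init S) (a p)).
  have eqW p : state_equiv_on W p (delta_word (init S) (a p)).
    have [Pa {1}<-] := aP p; exact: state_equiv_on_delta_word eqT _ Pa.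
  move=> p q eq_pq; apply: characterization_set_inj minH charW (eqW p) _.
  by rewrite eq_pq; apply: eqW.
rewrite -(card_codom inj_f); apply/subset_leq_card.
apply/fintype.subsetP=> _ /codomP[p ->].
by rewrite inE; apply: Delta_intro; case: (aP p).
Qed.

(** Induction on the remaining input [w], for all [u] in [V]: after reading [i], the word [u i] may
    leave [V], so it is exchanged for some [v] in [V] that leads to the same states in both
    machines. *)
Lemma mealy_equiv_closed_words H S V W X :
  minimal_mealy H -> characterization_set H W ->
  mealy_equiv_on (lang_cat X W) H S ->
  V [::] -> (forall u, V u -> X u) -> (forall u i, V u -> X (rcons u i)) ->
  (forall s i, Delta S V s -> Delta S V (delta s i)) ->
  mealy_equiv H S.
Proof.
move=> minH charW eqT V0 subVX stepVX closedV w _.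
have eqW := state_equiv_on_delta_word eqT.
suff bisim u : V u -> lambda_word (delta_word (init H) u) w =
                      lambda_word (delta_word (init S) u) w by apply: bisim V0.
elim: w u => //= i w IHw u Vu.
(* Any [w0] in [W] completes [u i] to a tested word, from which the output on [i] is read off. *)
have XVu := stepVX u i Vu; have [[w0 Ww0] _] := charW.
have := eqT _ (lang_catP XVu Ww0).
rewrite -cats1 -catA => /lambda_word_cat_inj[_ /= [-> _]]; congr (_ :: _).
(* [v] and [u i] agree in [S] by choice, hence in [H] by uniqueness of the partner. *)
have /DeltaP[v Vv eq_v] := closedV _ i (Delta_intro S Vu).
have eqWv := eqW _ (subVX v Vv); have eqWu := eqW _ XVu.
move: eqWu eqWv; rewrite eq_v !delta_word_rcons => eqWu eqWv.
by rewrite (characterization_set_inj minH charW eqWu eqWv) -eq_v IHw.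
Qed.

End Machines.

Theorem theorem1 (I : finType) (U : choiceType) (H : mealy I U) (k : nat)
    (P W : set (seq I))
    (Hmin : minimal_mealy H)
    (HP : minimal_state_cover H P)
    (HW : characterization_set H W) :
  complete H (fault_domain H k P) (ETS_AI H k P W).
Proof.
move=> S [leS nonsinkS]; rewrite /ETS_AI !lang_catA.
set J := active_inputs H in nonsinkS *; set A := lang_cat P _ => eqT.
have {HP} coverP := HP.1; have P0 := coverP.1.
have A_P u : P u -> A u by move=> Pu; apply: lang_cat_nil (words_le_nil _ _).
have eqPW : mealy_equiv_on (lang_cat P W) H S.
  move=> _ [u Pu [w Ww <-]]; apply/eqT/lang_catP => //.
  exact/lang_cat_nil/words_le_nil/A_P.
have leH := card_Delta_state_cover Hmin HW coverP eqPW.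
case: (Delta_card_or_stationary S P J k) => [leD|statS].
- pose V := lang_cat P (words_le J k).
  have V_A u : V u -> lang_cat A (words_le setT 1) u.
    case=> v Pv [w Jw <-]; rewrite /A -lang_catA; apply: lang_catP => //.
    (* The last letter of an active word of length at most [k] moves into the factor of arbitrary
       inputs; for [k = 0] there is no letter to move. *)
    case: k Jw {leS nonsinkS A eqT A_P eqPW leD V} => [|k] Jw.
      exact/lang_cat_nil/words_le_nil.
    case/lastP: w Jw => [|w i] Jw.
      exact/lang_cat_nil/words_le_nil/words_le_nil.
    have [Jw' _] := (words_le_rcons _ _ _ _).1 Jw.
    by rewrite -cats1; apply: lang_catP Jw' _; split.
  have fullV s : Delta S V s.
    (* The count [#|state H| + k] is also the upper bound on [#|state S|]. *)
    have /subset_cardP eqV : #|[pred s | `[< Delta S V s >]]| = #|state S|.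
      apply/eqP; rewrite eqn_leq max_card (leq_trans leS) //.
      by apply: leq_trans leD; rewrite leq_add2r.
    by apply/asboolP; have := eqV (subset_predT _) s; rewrite !unfold_in => ->.
  apply: (mealy_equiv_closed_words (V := V) Hmin HW eqT) => //.
  + exact/lang_cat_nil/words_le_nil.
  + move=> u /V_A[v Av [w w1 <-]]; apply: lang_catP => //.
    exact: words_leW w1.
  + move=> u i /V_A[v Av [w w1 <-]]; rewrite rcons_cat; apply: lang_catP => //.
    exact: words_leT_rcons.
(* Stationarity sharpens the bound [k] of the fault domain to [k.-1], leaving two free letters of
   the suite: one for [V], one for the next input. *)
- have nonsinkA s : ~ sinks S s -> Delta S A s by move=> /nonsinkS/statS.
  pose V := lang_cat A (words_le setT 1).
  have V_A u : A u -> V u by move=> Au; apply: lang_cat_nil (words_le_nil _ _).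
  apply: (mealy_equiv_closed_words (V := V) Hmin HW eqT).
  + exact/V_A/A_P.
  + move=> _ [v Av [w w1 <-]]; apply: lang_catP => //; exact: words_leW w1.
  + move=> _ i [v Av [w w1 <-]]; rewrite rcons_cat; apply: lang_catP => //.
    exact: words_leT_rcons.
  + move=> s i Vs; have [sink_s|/nonsinkA/DeltaP[u Au <-]] := pselect (sinks S s).
      by rewrite sink_s.
    by rewrite -delta_word_rcons -cats1; apply/Delta_intro/lang_catP => //.
Qed.
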